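(* For every $n$-dimensional polytope $\mathsf P\subseteq\mathbb R^n$, the Gherkin polytope $\mathsf G(\mathsf P)$ is indecomposable.
   Context: For an $n$-dimensional polytope $\mathsf P\subseteq\mathbb R^n$, the Fabergé egg polytope is the zonotope (Minkowski sum of segments) $$\mathrm F(\mathsf P)=\sum_{v\in\operatorname{Vert}(\mathsf P)}[\mathbf 0,(v,1)]\subseteq\mathbb R^{n+1},$$ and the Gherkin polytope is $\mathsf G(\mathsf P)=\mathrm F(\mathsf P)\cap\{x\in\mathbb R^{n+1} : x_{n+1}\ge1\}$. A deformation (weak Minkowski summand) of a polytope $\mathsf Q$ is a polytope $\mathsf Q'$ such that $\lambda\mathsf Q=\mathsf Q'+\mathsf Q''$ for some $\lambda>0$ and some polytope $\mathsf Q''$. A polytope $\mathsf Q$ is indecomposable if each of its deformations is a point or a translate of a positive dilate of $\mathsf Q$. *)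

(* Defs.v *)
From HB Require Import structures.
From mathcomp Require Import all_boot all_order all_algebra.
From mathcomp Require Import all_classical all_reals.

Set Implicit Arguments.
Unset Strict Implicit.
Unset Printing Implicit Defensive.

Import Order.TTheory GRing.Theory Num.Theory.

Local Open Scope classical_set_scope.
Local Open Scope ring_scope.

Section MinkowskiSum.
Variables (R : realType) (V : lmodType R).
Implicit Types (A B C : set V).

Definition msum A B : set V := [set a + b | a in A & b in B].

Lemma msumA : associative msum.
Proof.
move=> A B C; apply/seteqP; split=> x.
- by move=> [a Aa [_ [b Bb [c Cc <-]] <-]]; exists (a + b);
    [exists a => //; exists b | exists c => //; rewrite addrA].
- by move=> [_ [a Aa [b Bb <-]] [c Cc <-]]; exists a => //; exists (b + c);
    [exists b => //; exists c | rewrite addrA].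
Qed.

Lemma msumC : commutative msum.
Proof.
move=> A B; apply/seteqP; split=> x [a Aa [b Bb <-]];
  by exists b => //; exists a => //; rewrite addrC.
Qed.

Lemma msum0 : left_id [set 0] msum.
Proof.
move=> A; apply/seteqP; split=> [x [_ -> [a Aa <-]]|a Aa]; first by rewrite add0r.
by exists 0 => //; exists a => //; rewrite add0r.
Qed.

(* Makes the lemmas on \big[msum/[set 0]] available. *)
HB.instance Definition _ :=
  Monoid.isComLaw.Build (set V) [set 0] msum msumA msumC msum0.

Definition dilate (t : R) A : set V := [set t *: a | a in A].

Definition translate (v : V) A : set V := [set v + a | a in A].

Definition segment (a b : V) : set V :=
  [set x | exists2 t : R, 0 <= t <= 1 & x = (1 - t) *: a + t *: b].

Definition affine_hull A : set V :=
  [set x | exists (m : nat) (p : 'I_m -> V) (w : 'I_m -> R),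
    [/\ forall i, A (p i), \sum_i w i = 1 & x = \sum_i w i *: p i]].

Definition convex_hull A : set V :=
  [set x | exists (m : nat) (p : 'I_m -> V) (w : 'I_m -> R),
    [/\ forall i, A (p i), forall i, 0 <= w i,
        \sum_i w i = 1 & x = \sum_i w i *: p i]].

(* Polytopes are nonempty. *)
Definition polytope (P : set V) : Prop :=
  exists A, [/\ finite_set A, A !=set0 & P = convex_hull A].

Definition deformation (Q Q' : set V) : Prop :=
  polytope Q' /\
  exists (t : R) (Q'' : set V),
    [/\ 0 < t, polytope Q'' & dilate t Q = msum Q' Q''].

Definition indecomposable (Q : set V) : Prop :=
  polytope Q /\
  forall Q', deformation Q Q' ->
    (exists x, Q' = [set x]) \/
    (exists (v : V) (t : R), 0 < t /\ Q' = translate v (dilate t Q)).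

End MinkowskiSum.

Section FabergeEgg.
Variables (R : realType) (n : nat).
Implicit Types (P F : set 'rV[R]_n).

Definition has_dim P (d : nat) : Prop :=
  exists (x : 'rV[R]_n) (U : {vspace 'rV[R]_n}),
    affine_hull P = translate x [set` U] /\ \dim U = d.

Definition dot (c x : 'rV[R]_n) : R := \sum_i c 0 i * x 0 i.

Definition face P F : Prop :=
  exists (c : 'rV[R]_n) (b : R),
    (forall x, P x -> dot c x <= b) /\ F = P `&` [set x | dot c x = b].

(* The vertices of a polytope are its 0-dimensional faces, i.e. the faces
   that consist of a single point. *)
Definition vertices P : set 'rV[R]_n := [set v | face P [set v]].

(* The point (v, 1) of R^(n+1); the appended coordinate has index
   [rshift n 0], that is, n. *)
Definition lift1 (v : 'rV[R]_n) : 'rV[R]_(n + 1) := row_mx v (const_mx 1).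

(* [\big[_/_]_(v \in _)] is the iterated operation over a finite subset of a
   choice type; it is a genuine Minkowski sum because a polytope has finitely
   many vertices. *)
Definition faberge_egg P : set 'rV[R]_(n + 1) :=
  \big[@msum R 'rV[R]_(n + 1)/[set 0]]_(v \in vertices P)
    segment 0 (lift1 v).

Definition gherkin P : set 'rV[R]_(n + 1) :=
  faberge_egg P `&` [set x | 1 <= x 0 (rshift n 0)].

End FabergeEgg.

(* Main.v *)
Require Import Defs.
From mathcomp Require Import all_boot all_order all_algebra.
From mathcomp Require Import finmap all_classical all_reals.
From mathcomp Require Import lra.

(** Let [p i = (v_i, 1)] where [v_i] runs over the vertices of [P].  The Gherkin
    polytope is the convex hull of the sums [x_S] of the [p i], [i] in [S], over
    the nonempty sets [S] of vertices ([gherkinE]).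

    Let [Q'] be a deformation, with [Q' + Q'' = t G].  Choose [q S] in [Q'] and
    [q'' S] in [Q''] with [q S + q'' S = t x_S].  If a linear functional [f] is
    maximal over [G] at [x_S], then it is maximal over [Q'] at [q S].  Linear
    functionals restrict to the height-one slice as affine functions on [P], and
    [x_S] maximizes [f] whenever [f] is nonnegative on [S] and nonpositive off
    [S] ([sums_max_pos]), or when [S = {v}] and [f] is nonpositive with maximum
    at [v] ([sums_max1]).

    - Crossing a wall [f (p v) = 0] from [S] to [S + v] changes [q] by a
      nonnegative multiple of [p v] ([edge]).
    - That multiple is the same for [S] and for [S + u] when [v] and [u] are the
      only zeros of [f], since no three vertices of [P] are collinear
      ([parallelogram]).  Moving [f] inside the wall towards a functional that
      vanishes only at [v] and is positive at the other vertices, one zero at a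
      time ([crossing]), shows that the multiple is a number [coef v] that does
      not depend on [S] ([q_setU1]).  This path never leaves the nonempty sets
      [S], so that cutting off the origin does no harm.
    - Consequently [q S] is a constant plus the sum of the [coef i *: p i] for
      [i] in [S] ([q_signed]).
    - If [u] and [v] both maximize an affine function over [P], the two
      singletons maximize the same negative functional, which gives
      [coef u = coef v].
      Following such ties as in the simplex method, [coef] is constant
      ([coef_const]).

    Hence [q S = a + mu x_S] for some maximizer [x_S] of every functional
    ([deformation_normal_form]).  The polytopes [Q'] and [a + mu G] have the
    same support function, so they are equal by Farkas' lemma
    ([convex_hull_support]). *)

Set Implicit Arguments.
Unset Strict Implicit.
Unset Printing Implicit Defensive.

Import Order.TTheory GRing.Theory Num.Theory.

Local Open Scope classical_set_scope.
Local Open Scope ring_scope.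

(** * Linear functionals and Farkas' lemma *)

Section Dot.
Variables (R : realType) (d : nat).
Implicit Types (c e x y : 'rV[R]_d) (k : R).

Lemma dotDl c e x : dot (c + e) x = dot c x + dot e x.
Proof.
by rewrite /dot -big_split; apply: eq_bigr => i _; rewrite mxE mulrDl.
Qed.

Lemma dotDr c x y : dot c (x + y) = dot c x + dot c y.
Proof.
by rewrite /dot -big_split; apply: eq_bigr => i _; rewrite mxE mulrDr.
Qed.

Lemma dotZl k c x : dot (k *: c) x = k * dot c x.
Proof. by rewrite /dot mulr_sumr; apply: eq_bigr => i _; rewrite mxE mulrA. Qed.

Lemma dotZr k c x : dot c (k *: x) = k * dot c x.
Proof.
by rewrite /dot mulr_sumr; apply: eq_bigr => i _; rewrite mxE mulrCA.
Qed.

Lemma dotNl c x : dot (- c) x = - dot c x.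
Proof. by rewrite -scaleN1r dotZl mulN1r. Qed.

Lemma dotNr c x : dot c (- x) = - dot c x.
Proof. by rewrite -scaleN1r dotZr mulN1r. Qed.

Lemma dotBl c e x : dot (c - e) x = dot c x - dot e x.
Proof. by rewrite dotDl dotNl. Qed.

Lemma dotBr c x y : dot c (x - y) = dot c x - dot c y.
Proof. by rewrite dotDr dotNr. Qed.

Lemma dot0r c : dot c 0 = 0.
Proof. by rewrite -(scale0r 0) dotZr mul0r. Qed.

Lemma dot0l x : dot 0 x = 0.
Proof. by rewrite -(scale0r 0) dotZl mul0r. Qed.

Lemma dot_sumr c (J : Type) (r : seq J) (Q : pred J) (F : J -> 'rV[R]_d) :
  dot c (\sum_(j <- r | Q j) F j) = \sum_(j <- r | Q j) dot c (F j).
Proof.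
by apply: (big_morph (dot c)) => [x y|]; [exact: dotDr | exact: dot0r].
Qed.

Lemma dot_self_gt0 x : x != 0 -> 0 < dot x x.
Proof.
move=> x0; rewrite /dot lt_neqAle eq_sym psumr_neq0; last first.
  by move=> i _; rewrite -expr2 sqr_ge0.
rewrite sumr_ge0 ?andbT; last by move=> i _; rewrite -expr2 sqr_ge0.
have /rV0Pn[i xi] := x0; apply/hasP.
by exists i; rewrite ?mem_index_enum //= -expr2 exprn_even_gt0.
Qed.

Lemma dot_ext x y : (forall c, dot c x = dot c y) -> x = y.
Proof.
move=> xy; apply/eqP; rewrite -subr_eq0; apply: contraT => /dot_self_gt0.
by rewrite dotBr xy subrr ltxx.
Qed.

(** Farkas' lemma: a point outside the cone spanned by finitely many vectors
    is separated from that cone by a linear functional.  Induction on the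
    number of generators: when the functional obtained for [r] is positive on
    the new generator [a j], everything is projected along [a j] onto its
    kernel. *)
Lemma farkas (J : eqType) (r : seq J) (a : J -> 'rV[R]_d) (b : 'rV[R]_d) :
  uniq r ->
  (exists2 w : J -> R, forall j, 0 <= w j & b = \sum_(j <- r) w j *: a j) \/
  (exists2 f, forall j, j \in r -> dot f (a j) <= 0 & 0 < dot f b).
Proof.
elim: r a b => [|j r IH] a b /=.
  move=> _; have [->|b0] := eqVneq b 0.
    by left; exists (fun=> 0); rewrite ?big_nil.
  by right; exists b => //; exact: dot_self_gt0.
move=> /andP[jr ur].
have [[w w0 bE]|[f fr fb]] := IH a b ur.
  left; exists (fun i => if i == j then 0 else w i) => [i|].
    by case: ifP.
  rewrite big_cons eqxx scale0r add0r bE; apply: eq_big_seq => i ir.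
  by case: eqP ir jr => // -> ->.
have [faj|faj] := leP (dot f (a j)) 0.
  by right; exists f => // i; rewrite inE => /predU1P[->//|]; exact: fr.
have fj0 : dot f (a j) != 0 by rewrite gt_eqF.
pose pr x := x - (dot f x / dot f (a j)) *: a j.
have [[w w0 bE]|[f' f'r f'b]] := IH (pr \o a) (pr b) ur.
  left; pose k := (dot f b - \sum_(i <- r) w i * dot f (a i)) / dot f (a j).
  exists (fun i => if i == j then k else w i) => [i|].
    case: ifP => // _; rewrite divr_ge0 ?(ltW faj) // subr_ge0.
    apply: le_trans (ltW fb); rewrite big_seq; apply: sumr_le0 => l lr.
    by rewrite mulr_ge0_le0 // fr.
  rewrite big_cons eqxx.
  have -> : \sum_(i <- r) (if i == j then k else w i) *: a i =
            \sum_(i <- r) w i *: a i.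
    by apply: eq_big_seq => i ir; case: eqP ir jr => // -> ->.
  move: bE; rewrite /pr /= => /eqP; rewrite subr_eq => /eqP {1}->.
  under eq_bigr do rewrite scalerBr scalerA mulrA.
  rewrite sumrB -scaler_suml -mulr_suml /k mulrBl scalerBl.
  by rewrite addrAC [RHS]addrC addrA.
right; exists (f' - (dot f' (a j) / dot f (a j)) *: f); last first.
  move: f'b; rewrite /pr dotBl dotZl dotBr dotZr.
  by rewrite mulrAC [dot f _ * _]mulrC mulrAC.
move=> i; rewrite inE dotBl dotZl => /predU1P[->|/f'r].
  by rewrite divfK // subrr.
by rewrite /pr /= dotBr dotZr mulrAC [dot f _ * _]mulrC mulrAC.
Qed.

End Dot.

(** * Sign patterns of functionals on a finite configuration *)

Section Configuration.
Import mathcomp.boot.finset.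
Variables (R : realType) (d : nat) (I : finType) (p : I -> 'rV[R]_d).
Implicit Types (c e f g : 'rV[R]_d) (S T Z : {set I}) (i j u v : I).

(** The sum of the vectors [p i] for [i] in [T]. *)
Definition sums T : 'rV[R]_d := \sum_(i in T) p i.

(** [f] attains at [sums S] its maximum over the sums of nonempty sets. *)
Definition sums_max f S :=
  forall T, T != set0 -> dot f (sums T) <= dot f (sums S).

(** [f] is positive on [S], zero on [Z] and negative elsewhere. *)
Definition signed f S Z :=
  [/\ forall i, i \in S -> 0 < dot f (p i),
      forall i, i \in Z -> dot f (p i) = 0 &
      forall i, i \notin S -> i \notin Z -> dot f (p i) < 0].

Lemma dot_sums f T : dot f (sums T) = \sum_(i in T) dot f (p i).
Proof. exact: dot_sumr. Qed.

Lemma sums_max_pos f S :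
  (forall i, i \in S -> 0 <= dot f (p i)) ->
  (forall i, i \notin S -> dot f (p i) <= 0) -> sums_max f S.
Proof.
move=> fS fNS T _; rewrite !dot_sums [leLHS]big_mkcond [leRHS]big_mkcond /=.
apply: ler_sum => i _.
by case: ifPn => iT; case: ifPn => iS //; [exact: fNS | exact: fS].
Qed.

Lemma sums_max1 f i :
  (forall j, dot f (p j) <= dot f (p i)) -> dot f (p i) <= 0 ->
  sums_max f [set i]%SET.
Proof.
move=> fi fi0 T /set0Pn[j jT]; rewrite !dot_sums big_set1 (bigD1 j) //=.
rewrite -[leRHS]addr0 lerD ?fi //; apply: sumr_le0 => l _.
exact: le_trans (fi l) fi0.
Qed.

(** A small multiple of [e] changes no strict sign of [f]. *)
Lemma signed_perturb f S Z e : signed f S Z ->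
  exists2 t : R, 0 < t &
  [/\ forall i, i \in S -> 0 < dot (f + t *: e) (p i),
      forall i, i \in Z -> dot (f + t *: e) (p i) = t * dot e (p i) &
      forall i, i \notin S -> i \notin Z -> dot (f + t *: e) (p i) < 0].
Proof.
move=> [fS fZ fN].
have [t t0 tP] : exists2 t : R, 0 < t & forall i, dot f (p i) != 0 ->
    t * `|dot e (p i)| < `|dot f (p i)|.
  (* The summand 1 in the denominator makes the bound strict, and harmless when
     [e] vanishes at [p i]. *)
  pose m i := if dot f (p i) == 0 then 1
              else `|dot f (p i)| / (1 + `|dot e (p i)|).
  have m0 i : 0 < m i.
    rewrite /m; case: ifPn => // fi.
    by rewrite divr_gt0 ?normr_gt0 // ltr_wpDr.
  have [t t0 tm] : exists2 t : R, 0 < t & forall i, t <= m i.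
    have [i0 _|I0] := pickP I; last by exists 1 => // i; have := I0 i.
    exists (m [arg min_(i < i0) m i]%O) => // i.
    by case: arg_minP => // j _; apply.
  exists t => // i fi; have := tm i; rewrite /m (negPf fi).
  rewrite ler_pdivlMr ?ltr_wpDr // mulrDr mulr1 => H.
  by apply: lt_le_trans H; rewrite ltrDr.
exists t => //; split => i.
- move=> /fS fi; have := tP i; rewrite gt_eqF // => /(_ isT).
  rewrite dotDl dotZl (gtr0_norm fi) -[X in X * _ < _](gtr0_norm t0) -normrM.
  by rewrite ltr_norml => /andP[]; lra.
- by move=> /fZ fi; rewrite dotDl dotZl fi add0r.
- move=> iS iZ; have fi := fN _ iS iZ; have := tP i.
  rewrite lt_eqF // => /(_ isT).
  rewrite dotDl dotZl (ltr0_norm fi) -[X in X * _ < _](gtr0_norm t0) -normrM.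
  by rewrite ltr_norml => /andP[]; lra.
Qed.

(** Moving [f] along [g], which is zero on [Z] and positive elsewhere, until the
    first negative values vanish, then tilting, one reaches a functional with
    exactly one more zero, the other signs being unchanged.  The last hypothesis
    says that [p u] and [p w] are not proportional modulo the vectors indexed by
    [Z]; it makes the tilt possible. *)
Lemma crossing f g S Z :
  signed f S Z -> (exists i, i \notin S /\ i \notin Z) ->
  (forall i, i \in Z -> dot g (p i) = 0) ->
  (forall i, i \notin Z -> 0 < dot g (p i)) ->
  (forall u w, u \notin Z -> w \notin Z -> u != w ->
    exists2 e, forall i, i \in Z -> dot e (p i) = 0 &
      dot e (p u) * dot g (p w) != dot e (p w) * dot g (p u)) ->
  exists u f', [/\ u \notin S, u \notin Z & signed f' S (u |: Z)%SET].
Proof.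
move=> [fS fZ fN] [i0 [i0S i0Z]] gZ gN indep.
(* It suffices to reach a functional with some new zero: among these, the
   number of new zeros can be decreased to one. *)
suff main k h : (#|[set i | (i \notin S) && (i \notin Z) &&
                            (dot h (p i) == 0)%R]%SET| < k)%N ->
    (exists i, [/\ i \notin S, i \notin Z & dot h (p i) = 0]) ->
    (forall i, i \in S -> 0 < dot h (p i)) ->
    (forall i, i \in Z -> dot h (p i) = 0) ->
    (forall i, i \notin S -> i \notin Z -> dot h (p i) <= 0) ->
    exists u f', [/\ u \notin S, u \notin Z & signed f' S (u |: Z)%SET].
  pose r i := - dot f (p i) / dot g (p i).
  pose N := [pred i | (i \notin S) && (i \notin Z)].
  have Ni0 : N i0 by rewrite /N /= i0S.
  case: (@arg_minP _ _ _ i0 N r Ni0) => u /andP[uS uZ] rmin.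
  have ru0 : 0 < r u by rewrite divr_gt0 ?oppr_gt0 ?fN ?gN.
  apply: (main _.+1 (f + r u *: g)); first exact: ltnSn.
  - by exists u; split=> //; rewrite dotDl dotZl divfK ?subrr // gt_eqF ?gN.
  - move=> i iS; rewrite dotDl dotZl; apply: ltr_pwDl; first exact: fS.
    rewrite mulr_ge0 ?(ltW ru0) //.
    by have [/gZ->//|/gN/ltW] := boolP (i \in Z).
  - by move=> i iZ; rewrite dotDl dotZl fZ // gZ // mulr0 addr0.
  - move=> i iS iZ; have := rmin i; rewrite /N /= iS iZ => /(_ isT).
    by rewrite /r ler_pdivlMr ?gN // dotDl dotZl -/(r u); lra.
elim: k h => // k IH h hk [u [uS uZ hu]] hS hZ hN.
pose U := [set i | (i \notin S) && (i \notin Z) && (dot h (p i) == 0)%R]%SET.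
have inU i : (i \in U) = [&& i \notin S, i \notin Z & dot h (p i) == 0].
  by rewrite /U inE andbA.
have uU : u \in U by rewrite inU uS uZ hu eqxx.
have [[w /andP[wU wu]]|U1] := pselect (exists w, (w \in U) && (w != u));
  last first.
  exists u, h; split=> //; split=> // i.
    by rewrite !inE => /predU1P[->|/hZ].
  rewrite !inE negb_or => iS /andP[iu iZ].
  rewrite lt_neqAle hN // andbT; apply/negP => hi.
  by apply: U1; exists i; rewrite inU iS iZ hi.
have [wS wZ] : w \notin S /\ w \notin Z by move: wU; rewrite inU => /and3P[].
have [e eZ euw] := indep u w uZ wZ (contra_neq (esym (y:=_)) wu).
(* [e - r x *: g] is the tilt that keeps exactly the new zeros where the ratio
   [e / g] is maximal. *)
pose r i := dot e (p i) / dot g (p i).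
case: (@arg_maxP _ _ _ u [pred i in U] r uU) => x xU rmax.
rewrite /= in xU rmax.
have [xS xZ] : x \notin S /\ x \notin Z by move: xU; rewrite inU => /and3P[].
have tilt i : i \notin Z ->
    dot (e - r x *: g) (p i) = (r i - r x) * dot g (p i).
  by move=> iZ; rewrite dotBl dotZl mulrBl divfK // gt_eqF ?gN.
have /signed_perturb - /(_ (e - r x *: g))[t t0 [tS tZ tN]] :
    signed h S (U :|: Z)%SET.
  split=> // i; rewrite in_setU inU.
    by case/orP => [/and3P[_ _ /eqP]|/hZ].
  move=> iS; rewrite negb_or iS /= => /andP[hi iZ].
  by rewrite lt_neqAle hN // andbT; move: hi; rewrite iZ.
apply: (IH (h + t *: (e - r x *: g))).
- rewrite -ltnS; apply: leq_trans hk; rewrite ltnS; apply: proper_card.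
  apply/properP; split.
    apply/fintype.subsetP => i; rewrite !inE => /andP[/andP[iS iZ] hi].
    rewrite iS iZ /=; apply: contraLR hi => hi.
    by rewrite lt_eqF // tN // in_setU inU negb_or iS iZ hi.
  have [y yU ry] : exists2 y, y \in U & r y != r x.
    have [rux|] := eqVneq (r u) (r x); last by exists u.
    exists w => //; apply: contraNneq euw => rwx.
    have eE i : i \notin Z -> dot e (p i) = r i * dot g (p i).
      by move=> iZ; rewrite divfK // gt_eqF ?gN.
    by rewrite !eE // rux rwx mulrAC.
  exists y => //; rewrite !inE; apply/negP => /andP[/andP[yS yZ]].
  rewrite tZ ?in_setU ?yU // tilt // mulf_eq0 gt_eqF //= mulf_eq0 subr_eq0.
  by rewrite (negPf ry) gt_eqF ?gN.
- exists x; split=> //; rewrite tZ ?in_setU ?xU // tilt // subrr mul0r mulr0.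
  by [].
- exact: tS.
- move=> i iZ; rewrite tZ ?in_setU ?iZ ?orbT //.
  by rewrite dotBl dotZl eZ // gZ // mulr0 subr0 mulr0.
- move=> i iS iZ; have [iU|iU] := boolP (i \in U).
    rewrite tZ ?in_setU ?iU // tilt //.
    by rewrite pmulr_rle0 // pmulr_lle0 ?gN // subr_le0 rmax.
  by rewrite ltW // tN // in_setU negb_or iU.
Qed.

End Configuration.

(** * Points of a deformation that correspond to subset sums *)

Section Deformation.
Import mathcomp.boot.finset.
Variables (R : realType) (d : nat) (I : finType) (p : I -> 'rV[R]_d).
Variables (o : 'rV[R]_d) (g : I -> 'rV[R]_d) (q : {set I} -> 'rV[R]_d).
(* The vectors [p i] lie at height one for [o], and [g i] exposes [p i] among
   them. *)
Hypothesis op : forall i, dot o (p i) = 1.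
Hypothesis gpp : forall i, dot (g i) (p i) = 0.
Hypothesis gp_gt0 : forall i j, i != j -> 0 < dot (g i) (p j).
(* [q S] is the point of the deformation that corresponds to [sums S]. *)
Hypothesis q_max : forall f S T, S != set0 -> T != set0 ->
  sums_max p f S -> dot f (q T) <= dot f (q S).
Implicit Types (c e f : 'rV[R]_d) (S T Z : {set I}) (i j u v : I).

Notation signed := (signed p).

Lemma dot_q_eq f S T : S != set0 -> T != set0 ->
  sums_max p f S -> sums_max p f T -> dot f (q S) = dot f (q T).
Proof. by move=> S0 T0 fS fT; apply/eqP; rewrite eq_le !q_max. Qed.

Lemma setU1_neq0 i S : i |: S != set0.
Proof. by apply/set0Pn; exists i; rewrite setU11. Qed.

Lemma signed_addS f S i Z e :
  i \in Z -> i \notin S -> signed f S Z ->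
  (forall j, j \in Z -> j != i -> dot e (p j) = 0) ->
  0 < dot e (p i) ->
  exists2 t : R, 0 < t & signed (f + t *: e) (i |: S) (Z :\ i).
Proof.
move=> iZ iS fSZ eZ ei; have [t t0 [tS tZ tN]] := signed_perturb e fSZ.
exists t => //; split=> j.
- by rewrite in_setU1 => /predU1P[->|/tS//]; rewrite tZ // mulr_gt0.
- by rewrite in_setD1 => /andP[ji jZ]; rewrite tZ // eZ // mulr0.
- rewrite in_setU1 negb_or in_setD1 negb_and negbK => /andP[ji jS].
  by rewrite (negPf ji) /=; exact: tN.
Qed.

Lemma signed_subS f S i Z e :
  i \in Z -> i \notin S -> signed f S Z ->
  (forall j, j \in Z -> j != i -> dot e (p j) = 0) ->
  dot e (p i) < 0 ->
  exists2 t : R, 0 < t & signed (f + t *: e) S (Z :\ i).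
Proof.
move=> iZ iS fSZ eZ ei; have [t t0 [tS tZ tN]] := signed_perturb e fSZ.
exists t => //; split=> j.
- exact: tS.
- by rewrite in_setD1 => /andP[ji jZ]; rewrite tZ // eZ // mulr0.
- move=> jS; rewrite in_setD1 negb_and negbK => /predU1P[->|].
    by rewrite tZ // pmulr_rlt0.
  exact: tN.
Qed.

(** Both [S] and [i |: S] maximize every small perturbation of [f] that vanishes
    at [p i], so that all functionals vanishing at [p i] vanish at the
    difference. *)
Lemma edge f S i : S != set0 -> i \notin S -> signed f S [set i] ->
  exists2 a, 0 <= a & q (i |: S) - q S = a *: p i.
Proof.
move=> S0 iS fSi; set D := q (i |: S) - q S.
have wmax e : dot e (p i) = 0 -> exists2 t : R, 0 < t & dot (f + t *: e) D = 0.
  move=> ei; have [t t0 [tS tZ tN]] := signed_perturb e fSi.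
  have ti : dot (f + t *: e) (p i) = 0 by rewrite tZ ?set11 // ei mulr0.
  have tN' j : j \notin S -> dot (f + t *: e) (p j) <= 0.
    have [->|ji jS] := eqVneq j i; first by rewrite ti.
    by rewrite ltW // tN // in_set1.
  exists t => //; rewrite dotBr; apply/eqP; rewrite subr_eq0; apply/eqP.
  apply: dot_q_eq => //; first exact: setU1_neq0.
    apply: sums_max_pos => j; rewrite in_setU1.
      by case/predU1P => [->|/tS/ltW//]; rewrite ti.
    by rewrite negb_or => /andP[_]; exact: tN'.
  by apply: sums_max_pos => // j /tS/ltW.
have fD : dot f D = 0.
  by have [t _] := wmax 0 (dot0l _); rewrite scaler0 addr0.
have eD e : dot e (p i) = 0 -> dot e D = 0.
  move=> /wmax[t t0]; rewrite dotDl fD add0r dotZl => /eqP.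
  by rewrite mulf_eq0 gt_eqF //= => /eqP.
exists (dot o D).
  have [||t t0] := signed_addS (set11 i) iS fSi (e := o).
  - by move=> j; rewrite in_set1 => ->.
  - by rewrite op.
  move=> [tS _ tN]; have : 0 <= dot (f + t *: o) D.
    rewrite dotBr subr_ge0; apply: q_max => //; first exact: setU1_neq0.
    apply: sums_max_pos => j; first by move/tS/ltW.
    by move=> jS; rewrite ltW // tN // setDv in_set0.
  by rewrite dotDl fD add0r dotZl pmulr_rge0.
apply: dot_ext => c; rewrite dotZr.
have := eD (c - dot c (p i) *: o).
rewrite !dotBl !dotZl op mulr1 subrr => /(_ erefl) /eqP.
by rewrite subr_eq0 mulrC => /eqP.
Qed.

(** In the parallelogram on the sums of [S], [i |: S], [j |: S] and both, the
    deformation has parallel sides of equal length: [p i] and [p j] are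
    independent, and [g j] tells their coefficients apart. *)
Lemma parallelogram f S i j : S != set0 -> i != j ->
  i \notin S -> j \notin S -> signed f S [set i; j] ->
  q (i |: (j |: S)) - q (j |: S) = q (i |: S) - q S.
Proof.
move=> S0 ij iS jS fS.
have jset : [set i; j] :\ i = [set j].
  by apply/setP => x; rewrite !inE; case: eqVneq => // ->; rewrite (negPf ij).
have iset : [set i; j] :\ j = [set i].
  apply/setP => x; rewrite !inE; case: eqVneq => [->|]; rewrite ?orbF //.
  by rewrite eq_sym (negPf ij).
have eqgi x : x \in [set i; j] -> x != j -> dot (g i) (p x) = 0.
  by rewrite !inE => /orP[/eqP->|->].
have eqgj x : x \in [set i; j] -> x != i -> dot (g j) (p x) = 0.
  by rewrite !inE => /orP[->|/eqP->].
have gij := gp_gt0 ij; have gji : 0 < dot (g j) (p i).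
  by rewrite gp_gt0 // eq_sym.
have ijS : i \notin j |: S by rewrite in_setU1 negb_or ij.
have jiS : j \notin i |: S by rewrite in_setU1 negb_or eq_sym ij.
have iz : i \in [set i; j] by rewrite !inE eqxx.
have jz : j \in [set i; j] by rewrite !inE eqxx orbT.
have [t1 _] := signed_addS jz jS fS eqgi gij.
rewrite iset => /(edge (setU1_neq0 j S) ijS)[a1 _ e1].
have [||t2 _] := signed_subS jz jS fS (e := - g i).
- by move=> x xz xj; rewrite dotNl eqgi ?oppr0.
- by rewrite dotNl oppr_lt0.
rewrite iset => /(edge S0 iS)[a2 _ e2].
have [t3 _] := signed_addS iz iS fS eqgj gji.
rewrite jset => /(edge (setU1_neq0 i S) jiS)[b1 _ e3].
have [||t4 _] := signed_subS iz iS fS (e := - g j).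
- by move=> x xz xi; rewrite dotNl eqgj ?oppr0.
- by rewrite dotNl oppr_lt0.
rewrite jset => /(edge S0 jS)[b2 _ e4].
have : a1 *: p i + b2 *: p j = a2 *: p i + b1 *: p j.
  by rewrite -e1 -e2 -e3 -e4 setUCA addrA subrK [RHS]addrC addrA subrK.
move/(congr1 (dot (g j))); rewrite !dotDr !dotZr gpp !mulr0 !addr0.
by move/(mulIf (lt0r_neq0 gji)) => a12; rewrite e1 e2 a12.
Qed.

(** No three of the points are collinear, in dual form.  A suitable [e] is
    obtained from [g u] or from [g w] by subtracting the multiple of [o] that
    makes it vanish at [p v]. *)
Lemma triple_indep v u w : u != v -> w != v -> u != w ->
  exists2 e, dot e (p v) = 0 &
    dot e (p u) * dot (g v) (p w) != dot e (p w) * dot (g v) (p u).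
Proof.
move=> uv wv uw.
have gvu : 0 < dot (g v) (p u) by rewrite gp_gt0 // eq_sym.
have gvw : 0 < dot (g v) (p w) by rewrite gp_gt0 // eq_sym.
pose e i := g i - dot (g i) (p v) *: o.
have ev i : dot (e i) (p v) = 0 by rewrite dotBl dotZl op mulr1 subrr.
have [eu|] := eqVneq (dot (e u) (p u) * dot (g v) (p w))
                     (dot (e u) (p w) * dot (g v) (p u)); last by exists (e u).
exists (e w) => //; apply/eqP => ew; move: eu ew.
rewrite !dotBl !dotZl !op !mulr1 !gpp.
have guv := gp_gt0 uv; have gwv := gp_gt0 wv; have guw := gp_gt0 uw.
have gwu : 0 < dot (g w) (p u) by rewrite gp_gt0 // eq_sym.
move: gvu gvw guv gwv guw gwu.
set A := dot _ _; set B := dot _ _; set C := dot _ _.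
set X := dot _ _; set E := dot _ _; set F := dot _ _.
move=> A0 B0 C0 X0 E0 F0 h1 h2.
have h3 : C * (A - B) = E * A by lra.
have h4 : X * (B - A) = F * B by lra.
have : 0 < A - B by rewrite -(pmulr_rgt0 _ C0) h3 mulr_gt0.
have : 0 < B - A by rewrite -(pmulr_rgt0 _ X0) h4 mulr_gt0.
lra.
Qed.

(** The dilation factor of the edges parallel to [p v], read off at the edge
    that ends at the sum of all the vectors.  The default value 0 is for a
    single vector, where no edge exists. *)
Definition coef v : R := if [set: I] :\ v == set0 then 0
  else dot o (q [set: I] - q ([set: I] :\ v)).

(** By induction on the number of negative values of [f], all edges parallel to
    [p v] have the dilation factor of the topmost one. *)
Lemma q_setU1 f S v : S != set0 -> v \notin S -> signed f S [set v] ->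
  q (v |: S) = q S + coef v *: p v.
Proof.
move=> S0 vS fS.
suff -> : coef v *: p v = q (v |: S) - q S by rewrite addrC subrK.
have [k] := ubnP #|~: (v |: S)|; elim: k => // k IH in f S S0 vS fS *.
move=> hk; have [E|/set0Pn[x]] := eqVneq (~: (v |: S)) set0.
  have {}E : v |: S = [set: I] by rewrite -[LHS]setCK E setC0.
  have SE : S = [set: I] :\ v.
    apply/setP => x; have := in_setT x; rewrite -E !inE.
    by have [->|//] := eqVneq x v; rewrite (negPf vS).
  rewrite /coef -SE (negPf S0) -E.
  by have [a _ ->] := edge S0 vS fS; rewrite dotZr op mulr1.
rewrite !inE negb_or => /andP[xv xS].
have [||||u [f' [uS uv f'S]]] := @crossing _ _ _ p f (g v) S [set v] fS.
- by exists x; rewrite in_set1.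
- by move=> i; rewrite in_set1 => /eqP->.
- by move=> i; rewrite in_set1 => iv; rewrite gp_gt0 // eq_sym.
- move=> u w; rewrite !in_set1 => uv wv uw.
  have [e ev eN] := triple_indep uv wv uw.
  by exists e => // i; rewrite in_set1 => /eqP->.
rewrite in_set1 in uv.
rewrite -(@parallelogram f' S v u) //; last 2 first.
- by rewrite eq_sym.
- by rewrite setUC.
have uz : u \in [set u; v] by rewrite !inE eqxx.
have [||t t0 H] := signed_addS uz uS f'S (e := g v).
- by move=> j; rewrite !inE => /orP[->|/eqP->].
- by rewrite gp_gt0 // eq_sym.
have uvD : [set u; v] :\ u = [set v].
  by apply/setP => y; rewrite !inE; case: eqVneq => // ->; rewrite (negPf uv).
rewrite uvD in H; apply: (IH _ _ _ _ H); first exact: setU1_neq0.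
  by rewrite in_setU1 negb_or eq_sym uv.
rewrite -ltnS; apply: leq_trans hk; rewrite ltnS; apply: proper_card.
rewrite properC; apply/properP; split; first by rewrite setUS // subsetUr.
by exists u; rewrite !inE ?eqxx ?orbT // negb_or uv.
Qed.


(** The image of the origin under the expected affine map. *)
Definition base : 'rV[R]_d := q [set: I] - \sum_i coef i *: p i.

Lemma q_signed f S : S != set0 -> signed f S set0 ->
  q S = base + \sum_(i in S) coef i *: p i.
Proof.
have [k] := ubnP #|~: S|; elim: k => // k IH in f S *.
move=> hk S0 fS; have [E|/set0Pn[x xS]] := eqVneq (~: S) set0.
  rewrite -[S]setCK E setC0 /base.
  rewrite [X in _ + X](eq_bigl xpredT) => [|i]; last by rewrite in_setT.
  by rewrite subrK.
have [||||u [f' [uS _ f'S]]] := @crossing _ _ _ p f o S set0 fS.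
- by exists x; rewrite in_set0 -in_setC.
- by move=> i; rewrite in_set0.
- by move=> i _; rewrite op.
- move=> u w _ _ uw; exists (g u); first by move=> i; rewrite in_set0.
  by rewrite !op !mulr1 gpp lt_eqF // gp_gt0.
rewrite setU0 in f'S.
have [||t t0 H] := signed_addS (set11 u) uS f'S (e := o).
- by move=> j; rewrite in_set1 => ->.
- by rewrite op.
rewrite setDv in H.
have hu : (#|~: (u |: S)| < k)%N.
  rewrite -ltnS; apply: leq_trans hk; rewrite ltnS; apply: proper_card.
  rewrite properC; apply/properP; split; first exact: subsetUr.
  by exists u; rewrite // setU11.
have := IH _ _ hu (setU1_neq0 u S) H.
rewrite (q_setU1 S0 uS f'S) big_setU1 //= [coef u *: p u + _]addrC addrA.
exact: addIr.
Qed.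

Lemma q_set1 v : q [set v] = base + coef v *: p v.
Proof.
have fv : signed (- g v) set0 [set v].
  split=> i; rewrite ?in_set0 //.
    by rewrite in_set1 dotNl => /eqP->; rewrite gpp oppr0.
  by move=> _; rewrite in_set1 dotNl oppr_lt0 => iv; rewrite gp_gt0 // eq_sym.
have [|||t t0 H] := signed_addS (set11 v) _ fv (e := o).
- by rewrite in_set0.
- by move=> j; rewrite in_set1 => ->.
- by rewrite op.
have {}H : signed (- g v + t *: o) [set v] set0 by rewrite setU0 setDv in H.
rewrite (q_signed _ H) ?big_set1 //.
by apply/set0Pn; exists v; rewrite set11.
Qed.

Lemma coef_ge0 v : 0 <= coef v.
Proof.
rewrite /coef; case: eqVneq => // S0.
have fv : signed (g v) ([set: I] :\ v) [set v].
  split=> i; rewrite !inE ?andbT.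
  - by move=> iv; rewrite gp_gt0 // eq_sym.
  - by move/eqP->.
  - by move=> /negPn ->.
have [|a a0] := edge S0 _ fv; first by rewrite !inE eqxx.
by rewrite setD1K ?in_setT // => ->; rewrite dotZr op mulr1.
Qed.

(** Subtracting a multiple of [o] makes [f] negative with the same maximizers;
    [f] then cannot tell [q [set u]] from [q [set v]]. *)
Lemma coef_argmax f u v : (forall i, dot f (p i) <= dot f (p v)) ->
  dot f (p u) = dot f (p v) -> coef u = coef v.
Proof.
move=> fv fuv; pose h := f - (dot f (p v) + 1) *: o.
have hE i : dot h (p i) = dot f (p i) - dot f (p v) - 1.
  by rewrite dotBl dotZl op mulr1 opprD addrA.
have hv : dot h (p v) = - 1 by rewrite hE; lra.
have hu : dot h (p u) = - 1 by rewrite hE fuv; lra.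
have hle i : dot h (p i) <= - 1 by rewrite hE; have := fv i; lra.
have ne0 i : [set i] != set0 by apply/set0Pn; exists i; rewrite set11.
have : dot h (q [set u]) = dot h (q [set v]).
  apply: dot_q_eq => //; apply: sums_max1; rewrite ?hu ?hv ?lerN10 //.
rewrite !q_set1 !dotDr !dotZr hu hv; lra.
Qed.

(** Among the [v] with [coef v != coef w], take one where [g w] is smallest.
    Moving from a functional that exposes [v] towards one that exposes [w], the
    first tie is with a point where [g w] is smaller still, and this point has
    the same coefficient as [v]. *)
Lemma coef_const u w : coef u = coef w.
Proof.
apply/eqP; apply: contraT => uw.
pose A := [pred v | coef v != coef w].
case: (@arg_minP _ _ _ u A (fun v => dot (g w) (p v)) uw) => v vA vmin.
rewrite /= in vA vmin.
have vw : v != w by apply: contraNneq vA => ->.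
pose h i := dot (g w) (p v) - dot (g w) (p i).
pose r i := dot (g v) (p i) / h i.
pose B := [pred i | 0 < h i].
have Bw : B w by rewrite /B /= /h gpp subr0 gp_gt0 // eq_sym.
case: (@arg_minP _ _ _ w B r Bw) => x xB xmin; rewrite /= in xB xmin.
have r0 i : 0 < h i -> 0 <= r i.
  move=> hi; have [<-|vi] := eqVneq v i; first by rewrite /r gpp mul0r.
  by rewrite divr_ge0 ?ltW ?gp_gt0.
(* The functional [- g v - r x *: g w] is maximal at both [v] and [x]. *)
have xv : coef x = coef v.
  apply: (@coef_argmax (- (g v + r x *: g w))) => [i|].
    rewrite !dotNl lerN2 !dotDl !dotZl gpp add0r -subr_ge0 -addrA -mulrBr.
    have -> : dot (g w) (p i) - dot (g w) (p v) = - h i by rewrite opprB.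
    rewrite mulrN subr_ge0; have [hi|hi] := ltP 0 (h i).
      by rewrite -ler_pdivlMr // xmin.
    apply: le_trans (_ : 0 <= _).
      by rewrite mulr_ge0_le0 // r0.
    by have [<-|vi] := eqVneq v i; rewrite ?gpp // ltW ?gp_gt0.
  rewrite !dotNl !dotDl !dotZl gpp add0r; congr (- _); apply/eqP.
  rewrite -subr_eq0 -addrA -mulrBr.
  have -> : dot (g w) (p x) - dot (g w) (p v) = - h x by rewrite opprB.
  by rewrite mulrN /r divfK ?subrr // gt_eqF.
have := vmin x; rewrite xv => /(_ vA); move: xB; rewrite /h; lra.
Qed.

(** Every functional has a maximizer on which [q] is the homothety
    [x |-> a + mu *: x]. *)
Lemma deformation_normal_form (i0 : I) :
  exists (a : 'rV[R]_d) (mu : R), 0 <= mu /\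
  forall f, exists S, [/\ S != set0, sums_max p f S &
                         q S = a + mu *: sums p S].
Proof.
exists base, (coef i0); split; first exact: coef_ge0.
have qE f S : S != set0 -> signed f S set0 -> q S = base + coef i0 *: sums p S.
  move=> S0 /(q_signed S0) ->; rewrite scaler_sumr; congr (_ + _).
  by apply: eq_bigr => i _; rewrite (coef_const i i0).
move=> f; pose S := [set i | 0 < dot f (p i)].
have [E|S0] := eqVneq S set0; last first.
  exists S; split=> //.
    apply: sums_max_pos => i; first by rewrite inE => /ltW.
    by rewrite inE -leNgt.
  pose Z := [set i | dot f (p i) == 0].
  have : signed f S Z.
    split=> i; rewrite !inE //; first by move/eqP.
    by rewrite -leNgt => fi fi0; rewrite lt_neqAle fi0.
  move=> /signed_perturb - /(_ (- o))[t t0 [tS tZ tN]].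
  apply: (qE (f + t *: - o)) => //; split=> // i; first by rewrite in_set0.
  move=> iS _; have [iZ|iZ] := boolP (i \in Z); last exact: tN.
  by rewrite tZ // dotNl op mulrN1 oppr_lt0.
case: (@arg_maxP _ _ _ i0 xpredT (fun i => dot f (p i)) isT) => v _ vmax.
exists [set v]; split; first by apply/set0Pn; exists v; rewrite set11.
  apply: sums_max1 => [j|]; first exact: vmax.
  by have /setP/(_ v) := E; rewrite !inE => /negbT; rewrite -leNgt.
by rewrite q_set1 /sums big_set1 (coef_const v i0).
Qed.

End Deformation.

(** * Convex hulls and support functions *)

Section ConvexHull.
Variables (R : realType) (d : nat).
Implicit Types (A : set 'rV[R]_d) (f x y z : 'rV[R]_d) (b : R).

Lemma subset_convex_hull A x : A x -> convex_hull A x.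
Proof.
move=> Ax; exists 1%N, (fun=> x), (fun=> 1).
by split=> //; rewrite ?big_ord1 ?scale1r.
Qed.

Lemma convex_hull_seq A (J : eqType) (r : seq J) (x : J -> 'rV[R]_d)
    (w : J -> R) :
  (forall j, j \in r -> A (x j)) -> (forall j, 0 <= w j) ->
  \sum_(j <- r) w j = 1 -> convex_hull A (\sum_(j <- r) w j *: x j).
Proof.
move=> Ax w0 w1.
exists (size r), (fun k => x (tnth (in_tuple r) k)),
  (fun k => w (tnth (in_tuple r) k)); split=> //.
- by move=> k; apply: Ax; rewrite mem_tnth.
- by rewrite -w1 [RHS]big_tnth.
- by rewrite big_tnth.
Qed.

Lemma convex_hull_dot_le A f b y :
  (forall x, A x -> dot f x <= b) -> convex_hull A y -> dot f y <= b.
Proof.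
move=> Ab [m [x [w [Ax w0 w1 ->]]]].
rewrite dot_sumr -[leRHS]mul1r -w1 mulr_suml; apply: ler_sum => i _.
by rewrite dotZr ler_wpM2l // Ab.
Qed.

(** A convex combination lies on a supporting hyperplane only if all the points
    with a nonzero weight do. *)
Lemma convex_comb_face (m : nat) (x : 'I_m -> 'rV[R]_d) (w : 'I_m -> R) f b :
  (forall i, dot f (x i) <= b) -> (forall i, 0 <= w i) -> \sum_i w i = 1 ->
  dot f (\sum_i w i *: x i) = b -> forall i, w i != 0 -> dot f (x i) = b.
Proof.
move=> xb w0 w1 fb i wi.
have /eqP : \sum_i w i * (b - dot f (x i)) = 0.
  under eq_bigr do rewrite mulrBr.
  rewrite sumrB -mulr_suml w1 mul1r -{1}fb dot_sumr.
  by under eq_bigr do rewrite dotZr; rewrite subrr.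
rewrite psumr_eq0 => [|j _]; last by rewrite mulr_ge0 // subr_ge0.
move/allP/(_ i (mem_index_enum i)); rewrite /= mulf_eq0 (negPf wi) subr_eq0.
by move/eqP.
Qed.

(** The linear functional on the space one dimension higher that induces the
    affine function [x |-> dot f x + b] at height one. *)
Definition affine_form f b : 'rV[R]_(d + 1) := row_mx f (const_mx b).

Lemma dot_affine_form f b x : dot (affine_form f b) (lift1 x) = dot f x + b.
Proof.
rewrite /dot big_split_ord big_ord1 /=; congr (_ + _).
  by apply: eq_bigr => i _; rewrite !row_mxEl.
by rewrite !row_mxEr !mxE mulr1.
Qed.

Lemma affine_formP (f : 'rV[R]_(d + 1)) :
  f = affine_form (lsubmx f) (f 0 (rshift d 0)).
Proof.
rewrite -[LHS]hsubmxK /affine_form; congr row_mx.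
by apply/rowP => i; rewrite !mxE (ord1 i).
Qed.

(** A point belongs to a polytope when no linear functional is larger at this
    point than on the polytope.  This is Farkas' lemma one dimension higher. *)
Lemma convex_hull_support A z : finite_set A ->
  (forall f, exists2 x, convex_hull A x & dot f z <= dot f x) ->
  convex_hull A z.
Proof.
move=> /finite_seqP[s As] zA.
have [[w w0 zE]|[f fr fz]] :=
    farkas (@lift1 R d) (lift1 z) (undup_uniq s).
  have cE c b : dot c z + b = \sum_(j <- undup s) w j * (dot c j + b).
    rewrite -dot_affine_form zE dot_sumr; apply: eq_bigr => j _.
    by rewrite dotZr dot_affine_form.
  have w1 : \sum_(j <- undup s) w j = 1.
    have := cE 0 1; rewrite dot0l add0r => ->; apply: eq_bigr => j _.
    by rewrite dot0l add0r mulr1.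
  have -> : z = \sum_(j <- undup s) w j *: j.
    apply: dot_ext => c; have := cE c 0; rewrite addr0 => ->.
    by rewrite dot_sumr; apply: eq_bigr => j _; rewrite dotZr addr0.
  by apply: convex_hull_seq => // j; rewrite mem_undup As.
rewrite {}[f]affine_formP in fr fz; move: (lsubmx f) (f 0 _) fr fz => c b fr.
rewrite dot_affine_form => cz; have [x Ax zx] := zA c.
have : dot c x <= - b.
  apply: convex_hull_dot_le Ax => y; rewrite As /= -mem_undup => /fr.
  by rewrite dot_affine_form; lra.
by move: cz zx; lra.
Qed.

End ConvexHull.

(** * Indecomposability of the hull of the nonempty subset sums *)

Section NonemptySubsetSums.
Import mathcomp.boot.finset.
Variables (R : realType) (d : nat) (I : finType) (p : I -> 'rV[R]_d).

(** The sums of the vectors [p i] over nonempty sets of indices. *)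
Definition subset_sums : set 'rV[R]_d :=
  [set x | exists2 S : {set I}, S != set0 & x = sums p S]%classic.

Lemma finite_subset_sums : finite_set subset_sums.
Proof.
apply: (@sub_finite_set _ _ [set sums p S | S in [set: {set I}]]%classic).
  by move=> x [S _ ->]; exists S.
exact/finite_image/finite_finset.
Qed.

Lemma sums_max_hull f S y :
  sums_max p f S -> convex_hull subset_sums y -> dot f y <= dot f (sums p S).
Proof. by move=> fS; apply: convex_hull_dot_le => x [T T0 ->]; exact: fS. Qed.

Lemma subset_sums_indecomposable (o : 'rV[R]_d) (g : I -> 'rV[R]_d) :
  (forall i, dot o (p i) = 1) -> (forall i, dot (g i) (p i) = 0) ->
  (forall i j, i != j -> 0 < dot (g i) (p j)) -> (exists i : I, True) ->
  indecomposable (convex_hull subset_sums).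
Proof.
move=> op gpp gp_gt0 [i0 _]; set G := convex_hull subset_sums.
have Gsums S : S != set0 -> G (sums p S).
  by move=> S0; apply: subset_convex_hull; exists S.
split.
  exists subset_sums; split=> //; first exact: finite_subset_sums.
  exists (sums p [set i0]), [set i0] => //.
  by apply/set0Pn; exists i0; rewrite set11.
move=> Q' [[A' [finA' _ Q'E]] [t [Q'' [t0 _ GE]]]].
have /boolp.choice[q qP] (S : {set I}) : exists a, S != set0 ->
    Q' a /\ exists2 b, Q'' b & a + b = t *: sums p S.
  have [->|S0] := eqVneq S set0; first by exists 0.
  have : msum Q' Q'' (t *: sums p S).
    by rewrite -GE; exists (sums p S) => //; exact: Gsums.
  by move=> [a Qa [b Qb ab]]; exists a => _; split=> //; exists b.
have q_max f S y : S != set0 -> sums_max p f S -> Q' y ->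
    dot f y <= dot f (q S).
  move=> S0 fS Q'y; have [_ [b Q''b qb]] := qP S S0.
  have : msum Q' Q'' (y + b) by exists y => //; exists b.
  rewrite -GE => -[x Gx xyb]; have := sums_max_hull fS Gx.
  rewrite -(ler_pM2l t0) -!dotZr xyb -qb !dotDr lerD2r.
  by [].
have [a [mu [mu0 normal]]] : exists (a : 'rV[R]_d) (mu : R), 0 <= mu /\
    forall f, exists S, [/\ S != set0, sums_max p f S &
                           q S = a + mu *: sums p S].
  apply: (deformation_normal_form op gpp gp_gt0) => // f S T S0 T0 fS.
  by apply: q_max => //; have [] := qP T T0.
have Q'q S : S != set0 -> Q' (q S) by case/qP.
move: mu0; rewrite le_eqVlt => /predU1P[mu0|mu0]; [left|right].
  exists a; apply/seteqP; split=> [z Q'z|_ ->].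
    apply: dot_ext => f; apply/eqP; rewrite eq_le.
    have le h : dot h z <= dot h a.
      have [S [S0 hS qS]] := normal h.
      by have := q_max h S z S0 hS Q'z; rewrite qS -mu0 scale0r addr0.
    by have := le (- f); rewrite !dotNl lerN2 => ->; rewrite le.
  have [S [S0 _ qS]] := normal 0.
  by have := Q'q S S0; rewrite qS -mu0 scale0r addr0.
exists a, mu; split=> //; apply/seteqP; split=> [z Q'z|].
  have Gz : G (mu^-1 *: (z - a)).
    apply: convex_hull_support => [|f]; first exact: finite_subset_sums.
    have [S [S0 fS qS]] := normal f; exists (sums p S); first exact: Gsums.
    rewrite dotZr ler_pdivrMl // dotBr lerBlDl -dotZr -dotDr -qS.
    exact: q_max.
  exists (mu *: (mu^-1 *: (z - a))); first by exists (mu^-1 *: (z - a)).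
  by rewrite scalerA divff ?gt_eqF // scale1r addrC subrK.
move=> _ [_ [x Gx <-] <-]; rewrite Q'E; apply: convex_hull_support => // f.
have [S [S0 fS qS]] := normal f; exists (q S).
  by rewrite -Q'E; exact: Q'q.
by rewrite qS !dotDr !dotZr lerD2l ler_pM2l // sums_max_hull.
Qed.

End NonemptySubsetSums.

(** * Vertices and the Gherkin polytope *)

Section Gherkin.
Variables (R : realType).

Lemma msum_segmentsP (V : lmodType R) (J : eqType) (r : seq J) (F : J -> V) x :
  uniq r ->
  (\big[@msum R V/[set 0]]_(j <- r) segment 0 (F j)) x <->
  exists2 l : J -> R, forall j, 0 <= l j <= 1 & x = \sum_(j <- r) l j *: F j.
Proof.
elim: r x => [|j r IH] x /=.
  rewrite big_nil; split=> [->|[l _]]; last by rewrite big_nil => ->.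
  by exists (fun=> 0) => [j|]; rewrite ?lexx ?ler01 // big_nil.
move=> /andP[jr ur]; rewrite big_cons; split.
  move=> [_ [t t01 ->]] [y /(IH y ur)[l l01 ->] <-].
  exists (fun i => if i == j then t else l i) => [i|]; first by case: ifP.
  rewrite big_cons eqxx scaler0 add0r; congr (_ + _).
  by apply: eq_big_seq => i ir; case: eqP ir jr => // -> ->.
move=> [l l01 ->]; rewrite big_cons; exists (l j *: F j).
  by exists (l j); rewrite // scaler0 add0r.
by exists (\sum_(i <- r) l i *: F i) => //; apply/(IH _ ur); exists l.
Qed.

Lemma vertices_subset n (A : set 'rV[R]_n) :
  vertices (convex_hull A) `<=` A.
Proof.
move=> v [c [b [cb vE]]].
have [[m [x [w [Ax w0 w1 vx]]]] cv] :
    (convex_hull A `&` [set x | dot c x = b]) v.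
  by rewrite -vE.
have [i wi] : exists i, w i != 0.
  apply: contrapT => nw; have : \sum_i w i = 0.
    apply: big1 => i _; apply/eqP; apply: contrapT => wi.
    by apply: nw; exists i; apply/negP.
  by rewrite w1 => /eqP; rewrite oner_eq0.
have xb j : dot c (x j) <= b by apply/cb/subset_convex_hull.
rewrite /= vx in cv.
have xi : [set v] (x i).
  rewrite vE; split; first exact: subset_convex_hull.
  exact: (convex_comb_face xb w0 w1 cv).
by rewrite -xi.
Qed.

(** The crossing lemma, applied to the lifted generators and to the functional
    that is constantly [-1] on them, yields an affine function that vanishes at
    one generator and is negative at the others. *)
Lemma vertices_neq0 n (P : set 'rV[R]_n) : polytope P -> vertices P !=set0.
Proof.
move=> polyP; have [A [finA [x0 Ax0] ->]] :
    exists A : set 'rV[R]_n,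
      [/\ finite_set A, A !=set0 & P = convex_hull A] := polyP.
have memA (i : fset_set A) : A (val i).
  by have := valP i; rewrite in_fset_set // inE.
have x0A : x0 \in fset_set A by rewrite in_fset_set // inE.
pose o : 'rV[R]_(n + 1) := affine_form 0 1.
have op x : dot o (lift1 x) = 1 by rewrite dot_affine_form dot0l add0r.
have [|||||u [f [_ _ [_ fu fN]]]] := @crossing R _ (fset_set A)
  (fun i => lift1 (val i)) (- o) o finset.set0 finset.set0.
- by split=> i; rewrite ?finset.in_set0 // dotNl op ltrN10.
- by exists [` x0A]%fset; rewrite finset.in_set0.
- by move=> i; rewrite finset.in_set0.
- by move=> i _; rewrite op.
- move=> u w _ _ uw; exists (affine_form (val u - val w) 0).
    by move=> i; rewrite finset.in_set0.
  rewrite !op !mulr1 !dot_affine_form !addr0 -subr_eq0 -dotBr.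
  rewrite gt_eqF // dot_self_gt0 // subr_eq0.
  by apply: contraNneq uw => /val_inj->.
move: fu fN; rewrite [f]affine_formP; move: (lsubmx f) (f 0 _) => c b fu fN.
have cu : dot c (val u) = - b.
  have := fu u; rewrite finset.setU0 finset.set11 dot_affine_form => /(_ isT).
  by move/eqP; rewrite addr_eq0 => /eqP.
have cN x : A x -> x != val u -> dot c x < - b.
  move=> Ax xu; have xA : x \in fset_set A by rewrite in_fset_set // inE.
  have := fN [` xA]%fset; rewrite finset.in_set0 finset.setU0 finset.in_set1.
  rewrite -val_eqE /= xu dot_affine_form => /(_ isT isT).
  by lra.
have cA x : A x -> dot c x <= - b.
  by move=> Ax; have [->|/(cN x Ax)/ltW//] := eqVneq x (val u); rewrite cu.
exists (val u), c, (- b); split; first by move=> x; exact: convex_hull_dot_le.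
apply/seteqP; split=> [_ ->|y].
  by split=> //; exact/subset_convex_hull/memA.
move=> [[m [x [w [Ax w0 w1 ->]]]] /= yb].
have xb j : dot c (x j) <= - b by exact: cA.
have xu i : w i *: x i = w i *: val u.
  have [->|wi] := eqVneq (w i) 0; first by rewrite !scale0r.
  have xib := convex_comb_face xb w0 w1 yb wi.
  have [->//|/(cN _ (Ax i))] := eqVneq (x i) (val u).
  by rewrite xib ltxx.
by under eq_bigr do rewrite xu; rewrite -scaler_suml w1 scale1r.
Qed.

(** A functional is not larger at a point of the Gherkin polytope than at some
    nonempty subset sum: the indices with positive value if there are any, and
    otherwise a single index of largest value, since the coefficients add up to
    at least one. *)
Lemma gherkinE n (P : set 'rV[R]_n) : finite_set (vertices P) ->
  gherkin P = convex_hull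
    (subset_sums (fun i : fset_set (vertices P) => lift1 (val i))).
Proof.
move=> finV; set p := fun i => _.
pose I : finType := fset_set (vertices P).
pose o : 'rV[R]_(n + 1) := affine_form 0 1.
have oE x : dot o x = x 0 (rshift n 0).
  rewrite -[x]hsubmxK /dot big_split_ord big_ord1 /= big1 => [|i _].
    by rewrite !row_mxEr !mxE add0r mul1r.
  by rewrite !row_mxEl !mxE mul0r.
have op i : dot o (p i) = 1 by rewrite dot_affine_form dot0l add0r.
have fabergeP x : faberge_egg P x <->
    exists2 l : I -> R, forall i, 0 <= l i <= 1 & x = \sum_i l i *: p i.
  rewrite /faberge_egg fsbig_finite // big_seq_fsetE /=.
  exact/msum_segmentsP/index_enum_uniq.
apply/seteqP; split=> x.
  move=> [/fabergeP[l l01 xE] /=]; rewrite -oE => x1.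
  apply: convex_hull_support => [|f]; first exact: finite_subset_sums.
  have oxE : dot o x = \sum_i l i.
    by rewrite xE dot_sumr; apply: eq_bigr => i _; rewrite dotZr op mulr1.
  have fxE : dot f x = \sum_i l i * dot f (p i).
    by rewrite xE dot_sumr; apply: eq_bigr => i _; rewrite dotZr.
  pose S := [set i | 0 < dot f (p i)]%SET.
  have [S0|S0] := eqVneq S finset.set0; last first.
    exists (sums p S); first by apply: subset_convex_hull; exists S.
    rewrite fxE dot_sums [leRHS]big_mkcond /=; apply: ler_sum => i _.
    have /andP[l0 l1] := l01 i; rewrite finset.inE; case: ltP => fi.
      by rewrite -[leRHS]mul1r ler_wpM2r // ltW.
    by rewrite mulr_ge0_le0.
  have fle0 i : dot f (p i) <= 0.
    move/finset.setP: S0 => /(_ i).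
    by rewrite !finset.inE => /negbT; rewrite -leNgt.
  have [i0 _|noI] := pickP I; last first.
    by move: x1; rewrite oxE big_pred0 ?ler10 // => i; have := noI i.
  case: (@arg_maxP _ _ _ i0 xpredT (fun i => dot f (p i)) isT) => v _ vmax.
  exists (sums p [set v]%SET).
    apply: subset_convex_hull; exists [set v]%SET => //.
    by apply/finset.set0Pn; exists v; rewrite finset.set11.
  rewrite /sums finset.big_set1 fxE.
  apply: (@le_trans _ _ (\sum_i l i * dot f (p v))).
    apply: ler_sum => i _; have /andP[l0 _] := l01 i.
    by rewrite ler_wpM2l //; exact: vmax.
  rewrite -mulr_suml -oxE; rewrite -subr_ge0 -{1}[dot f (p v)]mul1r -mulrBl.
  by rewrite mulr_le0 // subr_le0.
move=> [m [y [w [Sy w0 w1 xE]]]].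
have /boolp.choice[S SP] k :
    exists S : {set I}, S != finset.set0 /\ y k = sums p S.
  by have [S S0 ->] := Sy k; exists S.
split.
  apply/fabergeP; exists (fun i => \sum_k w k * (i \in S k)%:R).
    move=> i; rewrite sumr_ge0 /= => [|k _]; last by rewrite mulr_ge0.
    rewrite -[leRHS]w1; apply: ler_sum => k _.
    by rewrite ler_piMr // lern1 leq_b1.
  rewrite xE; under [RHS]eq_bigr do rewrite scaler_suml.
  rewrite exchange_big /=; apply: eq_bigr => k _; have [_ ->] := SP k.
  rewrite /sums big_mkcond scaler_sumr; apply: eq_bigr => i _.
  by case: ifP; rewrite ?mulr1 ?mulr0 ?scale0r ?scaler0.
rewrite /= -oE xE dot_sumr -w1; apply: ler_sum => k _.
rewrite dotZr -[leLHS]mulr1 ler_wpM2l //.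
have [/finset.set0Pn[i iS] ->] := SP k.
rewrite dot_sums (bigD1 i) //= op lerDl sumr_ge0 // => j _.
by rewrite op.
Qed.

End Gherkin.

Theorem theorem7p13 (R : realType) (n : nat) (P : set 'rV[R]_n) :
  polytope P -> has_dim P n -> indecomposable (gherkin P).
Proof.
move=> polyP _; have [v0 v0P] := vertices_neq0 polyP.
have finV : finite_set (vertices P).
  have [A [finA _ ->]] := polyP.
  exact: sub_finite_set (@vertices_subset _ _ A) finA.
rewrite (gherkinE finV).
have memV (i : fset_set (vertices P)) : vertices P (val i).
  by have := valP i; rewrite in_fset_set // inE.
have vP v : vertices P v -> P v.
  move=> [c [b [_ vE]]].
  by have [] : (P `&` [set x | dot c x = b]) v by rewrite -vE.
have /boolp.choice[g gP] (i : fset_set (vertices P)) :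
    exists g : 'rV[R]_(n + 1), dot g (lift1 (val i)) = 0 /\
      forall j : fset_set (vertices P), i != j -> 0 < dot g (lift1 (val j)).
  have [c [b [cb vE]]] := memV i; exists (affine_form (- c) b).
  have [_ cv] : (P `&` [set x | dot c x = b]) (val i) by rewrite -vE.
  split=> [|j ij]; rewrite dot_affine_form dotNl addrC.
    by rewrite cv subrr.
  rewrite subr_gt0 lt_neqAle cb ?andbT; last exact/vP/memV.
  apply: contraNneq ij => jb; apply/eqP/val_inj/esym.
  have : (P `&` [set x | dot c x = b]) (val j) by split=> //; exact/vP/memV.
  by rewrite -vE.
apply: (@subset_sums_indecomposable _ _ _ _ (affine_form 0 1) g).
- by move=> i; rewrite dot_affine_form dot0l add0r.
- by move=> i; have [] := gP i.
- by move=> i j; have [_] := gP i; exact.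
- have v0V : v0 \in fset_set (vertices P) by rewrite in_fset_set // inE.
  by exists [` v0V]%fset.
Qed.
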